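(* There is a Borel set $W \subseteq \{1,2\}^\omega$ such that $\mathsf{HC}^*(W)=\bigcap_{w\in W}\mathsf{HC}(w)$ is properly co-analytic, i.e., co-analytic but not analytic. In particular, $\mathsf{HC}^*(W)$ is not Borel.
   Context: $\omega=\{0,1,2,\dots\}$; $\{1,2\}^\omega$ carries the product topology. $\ell^2$ is the Hilbert space of square-summable real sequences indexed by $\omega$ with its norm topology. For $w\in\{1,2\}^\omega$, $B_w:\ell^2\to\ell^2$ is $B_w(x)(i)=w(i)\,x(i+1)$. $\mathsf{HC}(w)$ is the set of $x\in\ell^2$ such that $\{B_w^k(x):k\in\omega\}$ is dense in $\ell^2$, and $\mathsf{HC}^*(W)=\bigcap_{w\in W}\mathsf{HC}(w)$. A subset of a Polish space is analytic if it is a continuous image of a Borel subset of a Polish space, and co-analytic if its complement is analytic. *)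

(* Defs.v *)
From HB Require Import structures.
From mathcomp Require Import all_boot all_order all_algebra.
From mathcomp Require Import all_classical all_reals all_analysis.
From mathcomp Require Import Rstruct Rstruct_topology.
Set Implicit Arguments. Unset Strict Implicit. Unset Printing Implicit Defensive.
Import Order.TTheory GRing.Theory Num.Theory.
Local Open Scope classical_set_scope.
Local Open Scope ring_scope.

Notation RR := Rdefinitions.R.

(* A Polish space, presented by a complete compatible metric:
   a Hausdorff (so the pseudometric is a metric), complete, separable
   metric space. *)
Definition polish (X : pseudoMetricType RR) : Prop :=
  [/\ hausdorff_space X,
      (forall F : set_system X, ProperFilter F -> cauchy F -> exists x : X, F --> x) &
      (exists D : set X, countable D /\ dense D)].

Definition borel {T : topologicalType} (A : set T) : Prop := <<s open >> A.

Definition seqR := nat -> RR.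

Definition l2 : set seqR :=
  [set x | (\sum_(i <oo) ((x i) ^+ 2)%:E < +oo)%E].

Definition l2norm (x : seqR) : RR :=
  Num.sqrt (fine (\sum_(i <oo) ((x i) ^+ 2)%:E)%E).

Definition l2dist (x y : seqR) : RR := l2norm (fun i => x i - y i).

Definition l2open (U : set seqR) : Prop :=
  U `<=` l2 /\
  forall x, U x -> exists2 e : RR, 0 < e &
    forall y, l2 y -> l2dist x y < e -> U y.

Definition l2borel (A : set seqR) : Prop := <<s l2, l2open >> A.

Definition l2dense (S : set seqR) : Prop :=
  forall y, l2 y -> forall e : RR, 0 < e ->
    exists2 s, S s & l2dist s y < e.

Definition l2analytic (A : set seqR) : Prop :=
  exists (X : pseudoMetricType RR) (B : set X) (f : X -> seqR),
    [/\ polish X, borel B,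
        (forall x, B x -> l2 (f x)),
        (forall x, B x -> forall e : RR, 0 < e -> exists2 d : RR, 0 < d &
            forall y, B y -> ball x d y -> l2dist (f x) (f y) < e) &
        f @` B = A].

Definition l2coanalytic (A : set seqR) : Prop := l2analytic (l2 `\` A).

(* {1,2}^omega is encoded as the Cantor space nat -> bool (product
   topology), with false |-> 1 and true |-> 2. *)
Definition weight (b : bool) : RR := if b then 2 else 1.

Definition Bw (w : cantor_space) (x : seqR) : seqR :=
  fun i => weight (w i) * x i.+1.

Definition HC (w : cantor_space) : set seqR :=
  [set x | l2 x /\ l2dense (range (fun k : nat => iter k (Bw w) x))].

Definition HCstar (W : set cantor_space) : set seqR :=
  [set x | l2 x /\ forall w, W w -> HC w x].

(* Main.v *)
Require Import Defs.
From HB Require Import structures.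
From mathcomp Require Import all_boot all_order all_algebra.
From mathcomp Require Import all_classical all_reals all_analysis.
From mathcomp Require Import Rstruct Rstruct_topology.
From mathcomp Require Import zify ring lra.
Set Implicit Arguments. Unset Strict Implicit. Unset Printing Implicit Defensive.
Import Order.TTheory GRing.Theory Num.Theory.
Import numFieldNormedType.Exports.
Local Open Scope classical_set_scope.

(* A point [c] of the Cantor space is read as (the code of) a tree of pairs of finite
   sequences; [souslin_code c] says that this tree has a branch along [c] itself.  By
   diagonalization the set of [c] with [~ souslin_code c] is not the projection of a
   closed subset of (Cantor space) x (Baire space), whereas every analytic or Borel set
   is such a projection.

   We map [c] continuously to a vector [coded_vector c], and pairs [(c, e)] to weights
   [coded_weight c e], so that [coded_vector c] is hypercyclic for [coded_weight c' e]
   exactly when [c <> c'].  The Borel set [W] consists of the [coded_weight c e] such that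
   [e] codes a witness of [souslin_code c]; thus [coded_vector c] lies in [HCstar W] iff
   [~ souslin_code c], and [HCstar W] is neither analytic nor Borel.

   The vector and the weights are built in stages.  To stage [j] a finite prefix [s] and a
   finite rational vector [q] are attached, every pair occurring infinitely often.  If [s]
   is a prefix of [c], then [coded_vector c] contains a block in stage [j], a copy of [q]
   scaled down by [2 ^ block_exp j].  The number of 2's of [coded_weight c' e] before this
   block is [block_exp j] if [s] is not a prefix of [c'], so that the shifted vector is
   close to a rescaling of [q]; otherwise it is [j] less, and the block is never amplified
   beyond norm 1.  If [c <> c'] then infinitely many stages separate [c] from [c']; if
   [c = c'] the first coordinate of the orbit stays bounded by 1. *)

(** * Analytic sets as projections of closed sets *)

Definition agree {T : Type} (n : nat) (a b : nat -> T) :=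
  forall i, (i < n)%N -> a i = b i.

Lemma agreeS T n (a b : nat -> T) : agree n a b -> agree n b a.
Proof. by move=> h i /h. Qed.

Lemma agreeT T n (a b c : nat -> T) : agree n a b -> agree n b c -> agree n a c.
Proof. by move=> h k i lin; rewrite h ?k. Qed.

Lemma agreeW T m n (a b : nat -> T) : (m <= n)%N -> agree n a b -> agree m a b.
Proof. by move=> mn h i lim; apply: h; apply: leq_trans mn. Qed.

Lemma mkseq_agree T n (a b : nat -> T) : mkseq a n = mkseq b n <-> agree n a b.
Proof.
split=> [e i lin|h]; last first.
  by apply/eq_in_map => i; rewrite mem_iota /= add0n => /h.
by have := congr1 (fun s => nth (a i) s i) e; rewrite !nth_mkseq.
Qed.

Section Souslin.
Variables (T : Type) (N : nat -> T -> T -> Prop).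
Hypotheses (Nrefl : forall n x, N n x x) (Nsym : forall n x y, N n x y -> N n y x).
Hypothesis Ncomp : forall n, exists m, forall x y z, N m x y -> N m y z -> N n x z.

(* [K] is closed in [T] x (Baire space over [I]), [N n x] being a base of neighborhoods of [x]. *)
Definition adherent_closed (I : Type) (K : T -> (nat -> I) -> Prop) :=
  forall x a,
    (forall n m, exists x' a', [/\ N n x x', agree m a a' & K x' a']) -> K x a.

Definition souslin (A : set T) :=
  exists2 K : T -> (nat -> nat) -> Prop, adherent_closed K &
    forall x, A x <-> exists a, K x a.

Definition nbhd_open (U : set T) :=
  forall x, U x -> exists n, forall y, N n x y -> U y.

(** [a 0] names a radius, and [x] has to lie in the closure of the set of [y] whose neighborhood of
    that radius is contained in [U]. Taking the closure makes [K] closed, and symmetry of [N] brings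
    [x] back into [U]. *)
Lemma souslin_open U : nbhd_open U -> souslin U.
Proof.
move=> oU.
exists (fun x a => forall n, exists2 y, N n x y & forall z, N (a 0) y z -> U z).
  move=> x a h n; have [m hm] := Ncomp n.
  have [x' [a' [xx' aa' /(_ m) [y x'y hy]]]] := h m 1.
  by exists y; [apply: hm x'y|rewrite aa'].
move=> x; split=> [/oU [n hn]|[a]].
  by exists (fun=> n) => m; exists x.
by move=> /(_ (a 0)) [y xy]; apply; apply: Nsym.
Qed.

Lemma souslin_setC_open U : nbhd_open U -> souslin (~` U).
Proof.
move=> oU; exists (fun x _ => ~ U x) => [x a h /oU[n hn]|x].
  by have [x' [a' [/hn]]] := h n 0.
by split=> [Ux|[]//]; exists (fun=> 0).
Qed.

Lemma souslin_bigcup (A : nat -> set T) :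
  (forall i, souslin (A i)) -> souslin (\bigcup_i A i).
Proof.
move=> /(_ _)/cid2-/all_sig2[K cK hK].
exists (fun x a => K (a 0) x (fun n => a n.+1)) => [x a h|x].
  apply: cK => n m; have [x' [a' [xx' aa' k]]] := h n m.+1.
  exists x', (fun n => a' n.+1); split=> //; last by rewrite aa'.
  by move=> i lim; rewrite aa'.
split=> [[i _ /hK[a ka]]|[a ka]]; last by exists (a 0) => //; apply/hK; eexists; eassumption.
by exists (fun n => if n is n'.+1 then a n' else i).
Qed.

(** One sequence carries witnesses for all [A i] at once, the [i]-th along the indices
    [pickle (i, n)]. *)
Lemma souslin_bigcap (A : nat -> set T) :
  (forall i, souslin (A i)) -> souslin (\bigcap_i A i).
Proof.
move=> /(_ _)/cid2-/all_sig2[K cK hK].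
exists (fun x a => forall i, K i x (fun n => a (pickle (i, n)))) => [x a h i|x].
  apply: cK => n m; have [x' [a' [xx' aa' k]]] := h n (\max_(j < m) pickle (i, j : nat)).+1.
  exists x', (fun n => a' (pickle (i, n))); split=> //.
  move=> j ljm; apply: aa'; rewrite ltnS.
  exact: (leq_bigmax (F := fun j : 'I_m => pickle (i, j : nat)) (Ordinal ljm)).
split=> [h|[a ka] i _]; last by apply/hK; eexists; apply: ka.
have /choice[b hb] : forall i, exists a, K i x a by move=> i; apply/hK/h.
exists (fun n => if unpickle n is Some (i, k) then b i k else 0) => i.
by under eq_fun do rewrite pickleK.
Qed.

(** Souslin sets need not be closed under complements; demanding the condition of both sides yields
    a sigma-algebra containing the open sets. *)
Definition bisouslin A := souslin A /\ souslin (~` A).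

Lemma bisouslin_open U : nbhd_open U -> bisouslin U.
Proof. by split; [apply: souslin_open|apply: souslin_setC_open]. Qed.

Lemma bisouslinC A : bisouslin A -> bisouslin (~` A).
Proof. by case=> h k; split; rewrite ?setCK. Qed.

Lemma bisouslin_bigcup (A : nat -> set T) :
  (forall i, bisouslin (A i)) -> bisouslin (\bigcup_i A i).
Proof.
move=> h; split; first by apply: souslin_bigcup => i; case: (h i).
by rewrite setC_bigcup; apply: souslin_bigcap => i; case: (h i).
Qed.

End Souslin.

Definition souslin_code (c : nat -> bool) : Prop :=
  exists a : nat -> nat * nat, forall n, c (pickle (mkseq c n, mkseq a n)).

(** Let [c] code the tree of pairs of prefixes of points of [P]. As [P] is closed, the branches
    along [c] are exactly the [a] with [P c a], so [souslin_code c] is equivalent to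
    [exists a, P c a], against the assumption at [c]. *)
Lemma not_souslin_code_diagonal (P : (nat -> bool) -> (nat -> nat * nat) -> Prop) :
  adherent_closed (@agree bool) P ->
  ~ (forall c, ~ souslin_code c <-> exists a, P c a).
Proof.
move=> cP h.
pose T (u : seq bool * seq (nat * nat)) :=
  exists c a, [/\ P c a, mkseq c (size u.1) = u.1 & mkseq a (size u.2) = u.2].
pose c n := if unpickle n is Some u then `[< T u >] else false.
have cE u : c (pickle u) <-> T u by rewrite /c pickleK; split => /asboolP.
have : (exists a, P c a) <-> souslin_code c.
  split=> [[a ha]|[a ha]]; exists a.
    by move=> n; apply/cE; exists c, a; rewrite !size_mkseq.
  apply: cP => n m; have /cE[c' [a' []]] := ha (maxn n m).
  rewrite /= !size_mkseq => k /mkseq_agree h1 /mkseq_agree h2.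
  exists c', a'; split=> //.
    by apply: agreeW (agreeS h1); lia.
  by apply: agreeW (agreeS h2); lia.
by rewrite -h; tauto.
Qed.

Local Open Scope ring_scope.

(** * Square-summable sequences *)

Lemma harmonic_small (e : RR) : 0 < e -> exists n : nat, n.+1%:R^-1 < e.
Proof.
move=> e0; exists (Num.bound e^-1).
have h := archi_boundP (ltW (etrans (invr_gt0 e) e0)).
by rewrite invf_plt ?posrE//; apply: lt_trans h _; rewrite ltr_nat.
Qed.

Definition sqsum (n : nat) (x : seqR) : RR := \sum_(0 <= i < n) x i ^+ 2.

Lemma sqsum_ge0 n x : 0 <= sqsum n x.
Proof. by apply: sumr_ge0 => i _; apply: sqr_ge0. Qed.

Lemma sqsum_nneseries_le n x :
  ((sqsum n x)%:E <= \sum_(i <oo) ((x i) ^+ 2)%:E)%E.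
Proof. by rewrite -sumEFin; apply: nneseries_lim_ge => i _; rewrite lee_fin sqr_ge0. Qed.

Lemma nneseries_le_sqsum x b : (forall n, sqsum n x <= b) ->
  (\sum_(i <oo) ((x i) ^+ 2)%:E <= b%:E)%E.
Proof.
move=> h; apply: lime_le.
  by apply: is_cvg_nneseries => n _ _; rewrite lee_fin sqr_ge0.
by apply: nearW => n; rewrite sumEFin lee_fin; apply: h.
Qed.

Lemma l2P x : l2 x <-> exists b, forall n, sqsum n x <= b.
Proof.
split=> [lx|[b /nneseries_le_sqsum h]]; last first.
  by apply: le_lt_trans h _; rewrite ltry.
exists (fine (\sum_(i <oo) ((x i) ^+ 2)%:E)%E) => n.
rewrite -lee_fin fineK ?sqsum_nneseries_le// ge0_fin_numE//.
by apply: nneseries_ge0 => i _ _; rewrite lee_fin sqr_ge0.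
Qed.

Lemma nneseries_fin_num x : l2 x -> ((\sum_(i <oo) ((x i) ^+ 2)%:E)%E \is a fin_num).
Proof.
move=> lx; rewrite ge0_fin_numE//.
by apply: nneseries_ge0 => i _ _; rewrite lee_fin sqr_ge0.
Qed.

Lemma l2norm_sqr x : l2 x -> l2norm x ^+ 2 = fine (\sum_(i <oo) ((x i) ^+ 2)%:E)%E.
Proof.
move=> lx; rewrite sqr_sqrtr// fine_ge0//.
by apply: nneseries_ge0 => i _ _; rewrite lee_fin sqr_ge0.
Qed.

Lemma l2norm_ge0 x : 0 <= l2norm x.
Proof. exact: sqrtr_ge0. Qed.

Lemma sqsum_le_l2norm x n : l2 x -> sqsum n x <= l2norm x ^+ 2.
Proof.
move=> lx; rewrite l2norm_sqr// -lee_fin fineK ?nneseries_fin_num//.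
exact: sqsum_nneseries_le.
Qed.

Lemma l2norm_le_sqsum x b : (forall n, sqsum n x <= b) -> l2norm x ^+ 2 <= b.
Proof.
move=> h; have lx : l2 x by apply/l2P; exists b.
by rewrite l2norm_sqr// -lee_fin fineK ?nneseries_fin_num// nneseries_le_sqsum.
Qed.

Lemma l2norm_lt_sqsum x b e : 0 < e -> b < e ^+ 2 -> (forall n, sqsum n x <= b) ->
  l2norm x < e.
Proof.
move=> e0 be h; rewrite -(@ltr_pXn2r _ 2)// ?nnegrE ?l2norm_ge0 ?(ltW e0)//.
exact: le_lt_trans (l2norm_le_sqsum h) be.
Qed.

Lemma sqsumD n (x y : seqR) :
  sqsum n (fun i => x i + y i) <= 2 * sqsum n x + 2 * sqsum n y.
Proof.
rewrite /sqsum !mulr_sumr -big_split/=; apply: ler_sum => i _.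
by have := sqr_ge0 (x i - y i); nra.
Qed.

Lemma sqsumN n (x : seqR) : sqsum n (fun i => - x i) = sqsum n x.
Proof. by apply: eq_bigr => i _; rewrite sqrrN. Qed.

Lemma sqsumB n (x y : seqR) :
  sqsum n (fun i => x i - y i) <= 2 * sqsum n x + 2 * sqsum n y.
Proof. by have := sqsumD n x (fun i => - y i); rewrite sqsumN. Qed.

Lemma sqsum_coord_le (x : seqR) i : x i ^+ 2 <= sqsum i.+1 x.
Proof. by rewrite /sqsum big_nat_recr//= lerDr sqsum_ge0. Qed.

Lemma sqsum_mono (x : seqR) m n : (m <= n)%N -> sqsum m x <= sqsum n x.
Proof.
move=> mn; rewrite /sqsum (big_cat_nat (leq0n m) mn)/= lerDl.
by apply: sumr_ge0 => i _; apply: sqr_ge0.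
Qed.

Lemma l2B x y : l2 x -> l2 y -> l2 (fun i => x i - y i).
Proof.
move=> /l2P[a ha] /l2P[b hb]; apply/l2P; exists (2 * a + 2 * b) => n.
by apply: le_trans (sqsumB n x y) _; have := ha n; have := hb n; lra.
Qed.

Lemma l2dist_ge0 x y : 0 <= l2dist x y.
Proof. exact: l2norm_ge0. Qed.

Lemma l2dist_coord_le x y i : l2 x -> l2 y -> `|x i - y i| <= l2dist x y.
Proof.
move=> lx ly; rewrite -(@ler_pXn2r _ 2)// ?nnegrE ?normr_ge0 ?l2norm_ge0//.
rewrite real_normK ?num_real//.
exact: le_trans (sqsum_coord_le (fun i => x i - y i) i) (sqsum_le_l2norm _ (l2B lx ly)).
Qed.

Lemma l2dist_sqr_triangle x y z : l2 x -> l2 y -> l2 z ->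
  l2dist x z ^+ 2 <= 2 * l2dist x y ^+ 2 + 2 * l2dist y z ^+ 2.
Proof.
move=> lx ly lz; apply: l2norm_le_sqsum => n.
have -> : (fun i => x i - z i) = (fun i => (x i - y i) + (y i - z i)).
  by apply/funext => i; rewrite addrA subrK.
apply: le_trans (sqsumD n (fun i => x i - y i) (fun i => y i - z i)) _.
have := sqsum_le_l2norm n (l2B lx ly); have := sqsum_le_l2norm n (l2B ly lz).
by rewrite /l2dist; lra.
Qed.

Lemma l2distC x y : l2dist x y = l2dist y x.
Proof.
congr (Num.sqrt (fine _)); apply: eq_eseriesr => i _.
by rewrite -sqrrN opprB.
Qed.

(** The equal points [u] and [v] stand for two descriptions of one point: in
    [not_l2analytic_of_code], a value of [f] and a coded vector. *)
Lemma l2_eq_of_close x y : l2 x -> l2 y ->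
  (forall e, 0 < e -> exists u v, [/\ l2 u, l2dist x u < e & u = v /\ l2dist v y < e]) ->
  x = y.
Proof.
move=> lx ly h; apply/funext => i; apply/eqP; rewrite -subr_eq0 -normr_eq0.
rewrite eq_le normr_ge0 andbT leNgt; apply/negP => e0.
set e := `|_| in e0.
have [|u [_ [lu xu [<- uy]]]] := h (e / 4); first by lra.
have := l2dist_sqr_triangle lx lu ly; have := l2dist_coord_le i lx ly.
rewrite -/e; have := l2dist_ge0 x u; have := l2dist_ge0 u y.
move: (l2dist x y) (l2dist x u) (l2dist u y) xu uy => a b c; nra.
Qed.

Lemma weight_bounds b : 1 <= weight b <= 2.
Proof. by rewrite /weight; case: b; lra. Qed.

Lemma l2_Bw w x : l2 x -> l2 (Bw w x).
Proof.
move=> /l2P[b hb]; apply/l2P; exists (4 * b) => n.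
have : sqsum n (Bw w x) <= 4 * sqsum n.+1 x.
  rewrite /sqsum big_nat_recl//= mulrDr; apply: le_trans (_ : 4 * \sum_(0 <= i < n) x i.+1 ^+ 2 <= _).
    rewrite mulr_sumr; apply: ler_sum => i _; rewrite /Bw exprMn ler_wpM2r ?sqr_ge0//.
    by have := weight_bounds (w i); nra.
  by rewrite lerDr mulr_ge0 ?sqr_ge0.
by have := hb n.+1; lra.
Qed.

Lemma l2_iter_Bw w x k : l2 x -> l2 (iter k (Bw w) x).
Proof. by move=> lx; elim: k => //= k; apply: l2_Bw. Qed.

Lemma iter_BwE w x k i :
  iter k (Bw w) x i = (\prod_(0 <= t < k) weight (w (i + t)%N)) * x (i + k)%N.
Proof.
elim: k i => [|k IH] i; first by rewrite big_geq// mul1r addn0.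
rewrite iterS /Bw IH big_nat_recl//= addn0 -mulrA; congr (_ * (_ * _)).
  by apply: eq_big_nat => t _; rewrite addnS addSn.
by rewrite addSnnS.
Qed.

(** * The coded vectors and weights *)

Fixpoint stage_start (j : nat) : nat :=
  if j is j'.+1 then (2 * stage_start j' + 6 * j' + 8)%N else 0%N.

Definition stage_len (j : nat) : nat := (stage_start j + 6 * j + 8)%N.

(** The padding is filled with 2's and is as long as everything before the stage and the rest of the
    stage together. Hence 2's make up at least half of every prefix, and when a block is shifted to
    the origin, later blocks do not move left of the start of their stages. *)
Definition pad (j : nat) : nat := (stage_start j + 3 * j + 4)%N.

Fixpoint locate (n : nat) : nat * nat :=
  if n is n'.+1 then
    let: (j, o) := locate n' in
    if (o.+1 < stage_len j)%N then (j, o.+1) else (j.+1, 0%N)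
  else (0%N, 0%N).

Definition block_start (j : nat) : nat := (stage_start j + pad j + 4 + j)%N.

Lemma block_startE j i :
  (block_start j + i = stage_start j + (pad j + (4 + (j + i))))%N.
Proof. by rewrite /block_start; lia. Qed.

Lemma stage_startS j : stage_start j.+1 = (stage_start j + stage_len j)%N.
Proof. by rewrite /stage_len /=; lia. Qed.

Lemma locateP n : n = (stage_start (locate n).1 + (locate n).2)%N /\
  ((locate n).2 < stage_len (locate n).1)%N.
Proof.
elim: n => [|n] //=; case: (locate n) => j o /= [ne ol].
case: ifPn => [|] /= ol'; first by split=> //; lia.
by rewrite /stage_len /=; move: ne ol ol'; rewrite /stage_len; lia.
Qed.

Lemma stage_start_mono i j : (i <= j)%N -> (stage_start i <= stage_start j)%N.
Proof.
by elim: j => [|j IH]; [case: i|rewrite leq_eqVlt ltnS => /predU1P[->//|/IH /=]; lia].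
Qed.

Lemma locate_ge n j : (stage_start j <= n)%N -> (j <= (locate n).1)%N.
Proof.
have [ne ol] := locateP n => jn; rewrite leqNgt; apply/negP => /stage_start_mono.
by rewrite stage_startS; lia.
Qed.

Lemma locateE j o : (o < stage_len j)%N -> locate (stage_start j + o) = (j, o).
Proof.
move=> ol; have [ne ol'] := locateP (stage_start j + o).
have jl : (j <= (locate (stage_start j + o)).1)%N by apply: locate_ge; lia.
have lj : ((locate (stage_start j + o)).1 <= j)%N.
  rewrite leqNgt; apply/negP => /stage_start_mono; rewrite stage_startS; lia.
move: ne ol' jl lj; case: (locate _) => j' o' /= ne ol' jl lj.
have ? : j = j' by lia.
by subst j'; congr pair; lia.
Qed.

(* The size bounds by [j] keep the data of stage [j] within the first [j] coordinates; they
   exclude no pair in the long run since the third component of the code is arbitrary. *)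
Definition target (j : nat) : seq bool * seq rat :=
  if (unpickle j : option (seq bool * seq rat * nat)) is Some (s, q, _) then
    if [&& (size s <= j)%N, (size q <= j)%N & all (fun v => `|v| <= j%:R) q]
    then (s, q) else ([::], [::])
  else ([::], [::]).

Lemma target_prefix_size j : (size (target j).1 <= j)%N.
Proof. by rewrite /target; case: unpickle => [[[s q] r]|]//; case: ifPn => // /and3P[]. Qed.

Lemma target_size j : (size (target j).2 <= j)%N.
Proof. by rewrite /target; case: unpickle => [[[s q] r]|]//; case: ifPn => // /and3P[]. Qed.

Lemma target_bound j i : `|(target j).2`_i| <= j%:R :> rat.
Proof.
rewrite /target; case: unpickle => [[[s q] r]|]; rewrite ?nth_nil ?normr0//.
case: ifPn => [/and3P[_ _ /allP h]|_] /=; rewrite ?nth_nil ?normr0//.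
by have [il|il] := ltnP i (size q); [apply/h/mem_nth|rewrite nth_default// normr0].
Qed.

Lemma pickle_cofinal (T : countType) (f : nat -> T) m : injective f ->
  exists r, (m <= pickle (f r))%N.
Proof.
move=> injf; apply: contrapT => h.
have hr r : (pickle (f r) < m)%N.
  by rewrite ltnNge; apply/negP => hh; apply: h; exists r.
(* Pigeonhole: [m + 1] distinct codes would lie below [m]. *)
have := @leq_card 'I_m.+1 'I_m (fun r => Ordinal (hr r)).
rewrite !card_ord ltnn => H; suff : false by [].
apply: H => r r' /(congr1 val)/= /(pcan_inj pickleK)/injf.
exact: val_inj.
Qed.

Lemma target_cofinal s q m : exists2 j, (m <= j)%N & target j = (s, q).
Proof.
have [b hb] : exists b : nat, all (fun v : rat => `|v| <= b%:R) q.
  elim: q => [|v q [b /allP hb]]; first by exists 0%N.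
  exists (b + Num.bound `|v|)%N; apply/allP => u; rewrite inE => /predU1P[->|/hb].
    by have := archi_boundP (normr_ge0 v); have := ler0n rat b; rewrite natrD; lra.
  by move=> /le_trans; apply; rewrite ler_nat leq_addr.
have [r hr] := @pickle_cofinal _ (fun r => (s, q, r)) (m + size s + size q + b)
  (fun r r' e => congr1 snd e).
exists (pickle (s, q, r)); first by lia.
rewrite /target pickleK ifT//; apply/and3P; split; [lia|lia|].
by apply: sub_all hb => v /le_trans; apply; rewrite ler_nat; lia.
Qed.

Definition hit (c : nat -> bool) j : bool :=
  mkseq c (size (target j).1) == (target j).1.

(* After the padding: the bits of [c] and [e], each followed by its negation so that the
   number of 2's does not depend on them; a region lowering the product before the block if
   the stage is hit; the block; and the compensation of that region. *)
Definition stage_bits (c e : nat -> bool) j : seq bool :=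
  nseq (pad j) true ++ [:: c j; ~~ c j; e j; ~~ e j] ++
  nseq j (~~ hit c j) ++ nseq j false ++ nseq j (hit c j).

Lemma size_stage_bits c e j : size (stage_bits c e j) = stage_len j.
Proof. by rewrite /stage_bits !size_cat !size_nseq /= /pad /stage_len; lia. Qed.

Definition coded_weight (c e : nat -> bool) (n : nat) : bool :=
  let: (j, o) := locate n in nth false (stage_bits c e j) o.

Definition ones (w : nat -> bool) (n : nat) : nat := \sum_(0 <= i < n) w i.

(** The number of 2's before stage [j] in every coded weight: each bit is paired with its negation,
    and exactly one of the two regions governed by [hit] consists of 2's. *)
Fixpoint stage_ones (j : nat) : nat :=
  if j is j'.+1 then (stage_ones j' + pad j' + 2 + j')%N else 0%N.

Definition block_exp (j : nat) : nat := (stage_ones j + pad j + 2 + j)%N.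

Lemma count_stage_bits c e j : count id (stage_bits c e j) = (pad j + 2 + j)%N.
Proof.
rewrite /stage_bits !count_cat !count_nseq /=.
by case: (c j) (e j) (hit c j) => [] [] []; lia.
Qed.

Lemma ones_stage_prefix c e j o :
  (o <= stage_len j)%N ->
  ones (coded_weight c e) (stage_start j + o) =
  (ones (coded_weight c e) (stage_start j) + count id (take o (stage_bits c e j)))%N.
Proof.
elim: o => [|o IH] ol; first by rewrite addn0 take0 addn0.
rewrite addnS /ones big_nat_recr//= -/(ones _ _) IH ?(ltnW ol)//.
rewrite (take_nth false) ?size_stage_bits// -cats1 count_cat /= addn0 addnA.
by congr (_ + _)%N; rewrite /coded_weight locateE.
Qed.

Lemma ones_stage_start c e j : ones (coded_weight c e) (stage_start j) = stage_ones j.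
Proof.
elim: j => [|j IH]; first by rewrite /ones big_geq.
rewrite stage_startS ones_stage_prefix// IH -(size_stage_bits c e) take_size.
by rewrite count_stage_bits /=; lia.
Qed.

Lemma onesE c e j o : (o <= stage_len j)%N ->
  ones (coded_weight c e) (stage_start j + o) =
  (stage_ones j + count id (take o (stage_bits c e j)))%N.
Proof. by move=> ol; rewrite ones_stage_prefix// ones_stage_start. Qed.

(** Inside the block all weights are 1, so the count is constant there; the region in front of it
    contributes [j] exactly if the stage is not hit. *)
Lemma ones_block c e j i : (i <= j)%N ->
  (ones (coded_weight c e) (block_start j + i) + j * hit c j = block_exp j)%N.
Proof.
move=> ij; rewrite block_startE onesE; last by rewrite /stage_len /pad; lia.
rewrite /stage_bits; set l := [:: c j; _; _; _].
have [sl cl] : size l = 4%N /\ count id l = 2%N by split=> //=; case: (c j) (e j) => [] [].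
rewrite take_cat size_nseq ifN -?leqNgt ?leq_addr// addKn.
rewrite take_cat sl (_ : (4 + (j + i) < 4)%N = false) ?addKn; last by lia.
rewrite take_cat size_nseq ifN -?leqNgt ?leq_addr// addKn.
rewrite take_cat size_nseq; set t := (X in _ ++ (_ ++ (_ ++ X))).
have ct : count id t = 0%N.
  rewrite /t; case: ifPn => ij'; first by rewrite take_nseq 1?ltnW // count_nseq.
  by rewrite count_cat count_nseq (_ : (i - j)%N = 0%N) ?take0 ?muln0//; lia.
rewrite !count_cat !count_nseq ct cl /=.
by rewrite /block_exp; case: hit; lia.
Qed.

Lemma stage_growth j : (stage_start j + 2 * j <= 2 * stage_ones j)%N.
Proof. by elim: j => //= j; rewrite /pad; lia. Qed.

(** The surplus [2 * (locate n).1] absorbs the factor [2 ^ j'] that bounds the entries of later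
    blocks in [good_stage_tail]. *)
Lemma ones_growth c e n : (n + 2 * (locate n).1 <= 2 * ones (coded_weight c e) n)%N.
Proof.
have [ne ol] := locateP n; rewrite {1 3}ne; move: (locate n) ol => [j o] /= ol.
rewrite onesE ?(ltnW ol)//; have := stage_growth j.
have : (minn o (pad j) <= count id (take o (stage_bits c e j)))%N.
  rewrite /stage_bits take_cat size_nseq; case: ltnP => oh.
    by rewrite take_nseq ?(ltnW oh)// count_nseq; lia.
  by rewrite count_cat count_nseq; lia.
by rewrite /minn; case: ltnP; move: ol; rewrite /stage_len /pad; lia.
Qed.

(** The default value 0 of [nth] ends the copy of the attached vector. *)
Definition coded_vector (c : nat -> bool) : seqR := fun n =>
  let: (j, o) := locate n in
  if hit c j && (pad j + 4 + j <= o)%N then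
    ratr (target j).2`_(o - (pad j + 4 + j)) / 2 ^+ block_exp j
  else 0.

Lemma coded_vector_block c j i : hit c j -> (i < j)%N ->
  coded_vector c (block_start j + i)%N = ratr (target j).2`_i / 2 ^+ block_exp j.
Proof.
move=> hj ij; rewrite block_startE /coded_vector locateE; last first.
  by rewrite /stage_len /pad; lia.
by rewrite hj !addnA leq_addr /= addKn.
Qed.

Lemma coded_vector_supp c n : coded_vector c n <> 0 ->
  exists j i, [/\ n = (block_start j + i)%N, (i < j)%N, hit c j &
    `|coded_vector c n| <= j%:R / 2 ^+ block_exp j].
Proof.
have [ne _] := locateP n; move: ne.
rewrite /coded_vector; case: (locate n) => j o /= ->.
case: ifPn => // /andP[hj oj] nz.
exists j, (o - (pad j + 4 + j))%N; split=> //; first by rewrite /block_start; lia.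
  apply: leq_trans (target_size j); rewrite ltnNge; apply/negP => h.
  by apply: nz; rewrite nth_default// raddf0 mul0r.
rewrite normrM normfV [`|2 ^+ _|]ger0_norm ?exprn_ge0// ler_wpM2r ?invr_ge0 ?exprn_ge0//.
by rewrite -ratr_norm -[leRHS](ratr_nat _ j) ler_rat target_bound.
Qed.

Lemma geometric_sum_le m n : \sum_(m <= i < n) (2^-1 : RR) ^+ i <= 2 * 2^-1 ^+ m.
Proof.
have [mn|nm] := leqP m n; last first.
  by rewrite big_geq ?(ltnW nm)// mulr_ge0// exprn_ge0// invr_ge0.
suff -> : \sum_(m <= i < n) (2^-1 : RR) ^+ i = 2 * 2^-1 ^+ m - 2 * 2^-1 ^+ n.
  by rewrite gerBl mulr_ge0// exprn_ge0// invr_ge0.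
elim: n mn => [|n IH]; first by rewrite leqn0 => /eqP->; rewrite big_geq// subrr.
rewrite leq_eqVlt => /predU1P[->|mn]; first by rewrite big_geq// subrr.
by rewrite big_nat_recr//= IH// exprS; set t := 2^-1 ^+ n; field.
Qed.

Lemma geometric_small (e : RR) : 0 < e -> exists m, 2^-1 ^+ m < e.
Proof.
move=> e0; exists (Num.bound e^-1).
have h := archi_boundP (ltW (etrans (invr_gt0 e) e0)).
rewrite exprVn invf_plt ?posrE ?exprn_gt0//; apply: lt_le_trans h _.
by rewrite -natrX ler_nat ltnW// ltn_expl.
Qed.

Lemma le_half_exp (a : RR) n : a * 2 ^+ n <= 1 -> a <= 2^-1 ^+ n.
Proof. by move=> h; rewrite exprVn -div1r ler_pdivlMr ?exprn_gt0. Qed.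

(** [block_exp j] exceeds half of each position in the block by enough to absorb the factor
    [j <= 2 ^ j]. The bound is uniform in [c], which gives both membership in l2 and continuity in
    [c]. *)
Lemma coded_vector_sqr_le c n : coded_vector c n ^+ 2 <= 2^-1 ^+ n.
Proof.
have [->|/eqP/coded_vector_supp[j [i [-> ij _ h]]]] := eqVneq (coded_vector c n) 0.
  by rewrite expr0n exprn_ge0// invr_ge0.
apply: le_half_exp; rewrite -real_normK ?num_real//.
apply: (@le_trans _ _ ((j%:R / 2 ^+ block_exp j) ^+ 2 * 2 ^+ (block_start j + i))).
  by rewrite ler_wpM2r ?exprn_ge0// ler_pXn2r ?nnegrE// ?divr_ge0 ?exprn_ge0.
rewrite expr_div_n mulrAC ler_pdivrMr ?exprn_gt0// mul1r -exprM -!natrX -natrM ler_nat.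
apply: (@leq_trans ((2 ^ j) ^ 2 * 2 ^ (block_start j + i))%N).
  by rewrite leq_mul2r leq_exp2r// (ltnW (ltn_expl _ _))// orbT.
rewrite -expnM -expnD leq_exp2l//.
by have := stage_growth j; rewrite /block_exp /block_start /pad; lia.
Qed.

Lemma sqsum_tail_le m n (x : seqR) : (forall i, (m <= i)%N -> x i ^+ 2 <= 2^-1 ^+ i) ->
  \sum_(m <= i < n) x i ^+ 2 <= 2 * 2^-1 ^+ m.
Proof.
move=> h; apply: le_trans (geometric_sum_le m n).
by rewrite big_nat_cond [leRHS]big_nat_cond; apply: ler_sum => i /andP[/andP[/h]].
Qed.

Lemma l2_coded_vector c : l2 (coded_vector c).
Proof.
apply/l2P; exists (2 * 2^-1 ^+ 0) => n; apply: sqsum_tail_le => i _.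
exact: coded_vector_sqr_le.
Qed.

Lemma hit_agree n c c' j : agree n c c' -> (j <= n)%N -> hit c j = hit c' j.
Proof.
move=> cc jn; rewrite /hit; congr (_ == _); apply/mkseq_agree.
by apply: agreeW cc; apply: leq_trans (target_prefix_size j) jn.
Qed.

Lemma stage_start_ge j : (j <= stage_start j)%N.
Proof. by elim: j => //= j; lia. Qed.

Lemma locate_le n : ((locate n).1 <= n)%N.
Proof.
by have [ne _] := locateP n; rewrite {2}ne; have := stage_start_ge (locate n).1; lia.
Qed.

Lemma coded_vector_agree m c c' n : agree m c c' -> (n <= m)%N ->
  coded_vector c n = coded_vector c' n.
Proof.
move=> cc nm; have := locate_le n; rewrite /coded_vector.
by case: (locate n) => j o /= jn; rewrite (hit_agree cc)//; lia.
Qed.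

Lemma coded_vector_continuous c e : 0 < e -> exists n, forall c', agree n c c' ->
  l2dist (coded_vector c) (coded_vector c') < e.
Proof.
move=> e0; have [|m hm] := @geometric_small (e ^+ 2 / 8); first by rewrite divr_gt0// exprn_gt0.
exists m => c' cc.
(* Terms below [m] vanish; as [(a - b) ^ 2 <= 2 * a ^ 2 + 2 * b ^ 2], each later term is at most
   [4 * 2^-1 ^ i]. *)
apply: (@l2norm_lt_sqsum _ (4 * (2 * 2^-1 ^+ m))) => //; first by lra.
move=> n; apply: le_trans (sqsum_mono _ (leq_maxl n m)) _.
rewrite /sqsum (big_cat_nat (leq0n m) (leq_maxr n m))/=.
rewrite [X in X + _]big_nat_cond big1 ?add0r; last first.
  move=> i /andP[/andP[_ im] _]; rewrite (coded_vector_agree cc) ?subrr ?expr0n//.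
  exact: ltnW.
apply: le_trans (ler_wpM2l _ (geometric_sum_le m (maxn n m))); last by [].
rewrite mulr_sumr; apply: ler_sum => i _.
have := coded_vector_sqr_le c i; have := coded_vector_sqr_le c' i.
move: (coded_vector c i) (coded_vector c' i) (2^-1 ^+ i) => a b t.
by have := sqr_ge0 (a + b); nra.
Qed.

(** * Hypercyclicity of the coded vectors *)

Lemma prod_weight_ones w i k :
  2 ^+ ones w i * (\prod_(0 <= t < k) weight (w (i + t)%N)) = 2 ^+ ones w (i + k).
Proof.
elim: k => [|k IH]; first by rewrite big_geq// addn0 mulr1.
rewrite big_nat_recr//= mulrA IH addnS /ones big_nat_recr//= exprD.
by rewrite /weight; case: (w _); rewrite ?expr1 ?expr0.
Qed.

(** Turns estimates of orbits into counts of 2's in prefixes of the weight. *)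
Lemma iter_Bw_ones w x k i :
  iter k (Bw w) x i = 2 ^+ ones w (i + k) * x (i + k)%N / 2 ^+ ones w i.
Proof.
by rewrite iter_BwE -prod_weight_ones; field; rewrite expf_neq0.
Qed.

Lemma nat_lt_exp2 (j : nat) : j%:R <= (2 ^+ j : RR).
Proof. by rewrite -natrX ler_nat ltnW// ltn_expl. Qed.

Lemma coded_vector_not_HC c e : ~ HC (coded_weight c e) (coded_vector c).
Proof.
(* The orbit stays at distance at least 1 from twice the first unit vector. *)
move=> [lx /(_ (fun i => if i == 0%N then 2 else 0))].
have ly : l2 (fun i => if i == 0%N then 2 else 0).
  apply/l2P; exists 4; case=> [|n]; first by rewrite /sqsum big_geq.
  rewrite /sqsum big_nat_recl//= big1 => [|i _]; last by rewrite expr0n.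
  by lra.
move=> /(_ ly 1 ltr01)[_ [k _ <-]].
have := l2dist_coord_le 0%N (l2_iter_Bw (coded_weight c e) k lx) ly.
move=> /= h1 h2; have {h1 h2} : `|iter k (Bw (coded_weight c e)) (coded_vector c) 0%N - 2| < 1.
  exact: le_lt_trans h1 h2.
rewrite iter_Bw_ones add0n {2}/ones big_geq// divr1.
suff : `|2 ^+ ones (coded_weight c e) k * coded_vector c k| <= 1.
  move: (_ * _) => t; rewrite ler_norml ltr_norml => /andP[h1 h2] /andP[h3 h4]; lra.
have [->|/eqP/coded_vector_supp[j [i [-> ij hj h]]]] := eqVneq (coded_vector c k) 0.
  by rewrite mulr0 normr0.
rewrite normrM ger0_norm ?exprn_ge0//.
apply: le_trans (ler_wpM2l _ h) _; first by rewrite exprn_ge0.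
(* In a hit stage the exponent is [block_exp j - j], so [2 ^ j] remains in the denominator against
   an entry bounded by [j]. *)
have := ones_block c e (ltnW ij); rewrite hj muln1 => <-.
rewrite mulrA ler_pdivrMr ?exprn_gt0// mul1r exprD ler_wpM2l ?exprn_ge0//.
exact: nat_lt_exp2.
Qed.

Section GoodStage.
Variables (c c' e : nat -> bool) (j : nat).
Hypotheses (hc : hit c j) (hc' : ~~ hit c' j).
Let z := iter (block_start j) (Bw (coded_weight c' e)) (coded_vector c).

(** As [c'] does not hit the stage, the number of 2's before the block is exactly the scaling
    exponent. The remaining division is anticipated in [coded_vector_HC] by the choice of the
    rational vector. *)
Lemma good_stage_head i : (i < j)%N ->
  z i = ratr (target j).2`_i / 2 ^+ ones (coded_weight c' e) i.
Proof.
move=> ij; rewrite /z iter_Bw_ones addnC coded_vector_block//.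
have := ones_block c' e (ltnW ij); rewrite (negbTE hc') muln0 addn0 => ->.
by rewrite [2 ^+ _ * _]mulrC divfK// expf_neq0.
Qed.

(** Only blocks of stages [j' > j] reach these coordinates. Before the final division their entries
    are amplified to at most [j' <= 2 ^ j'], and [i] lies in stage [j'] or later, so [ones_growth]
    applies. *)
Lemma good_stage_tail i : (j <= i)%N -> z i ^+ 2 <= 2^-1 ^+ i.
Proof.
move=> ji; rewrite /z iter_Bw_ones.
set n := (i + block_start j)%N.
have [->|/eqP/coded_vector_supp[j' [i' [ne ij hj h]]]] := eqVneq (coded_vector c n) 0.
  by rewrite mulr0 mul0r expr0n exprn_ge0// invr_ge0.
have jj : (j < j')%N.
  rewrite ltnNge; apply/negP; rewrite leq_eqVlt => /predU1P[E|/stage_start_mono].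
    by move: ne ij ji; rewrite E /n; lia.
  by rewrite stage_startS; move: ne; rewrite /n /block_start /stage_len /pad; lia.
(* The padding of stage [j'] outweighs the shift by [block_start j]. *)
have j'l : (j' <= (locate i).1)%N.
  apply: locate_ge; have := stage_start_mono jj; rewrite stage_startS.
  by move: ne; rewrite /n /block_start /stage_len /pad; lia.
rewrite -real_normK ?num_real// !normrM normfV !(ger0_norm (exprn_ge0 _ _))//.
set t := _ / _; have t0 : 0 <= t by rewrite /t divr_ge0// ?mulr_ge0// exprn_ge0.
have tle : t <= 2 ^+ j' / 2 ^+ ones (coded_weight c' e) i.
  rewrite /t ler_wpM2r ?invr_ge0 ?exprn_ge0//.
  apply: (@le_trans _ _ (2 ^+ block_exp j' * (j'%:R / 2 ^+ block_exp j'))).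
    apply: ler_pM => //; rewrite ?exprn_ge0// ne ler_eXn2l ?ltr1n//.
    by have := ones_block c' e (ltnW ij); lia.
  by rewrite mulrC divfK ?expf_neq0// nat_lt_exp2.
apply: le_half_exp.
apply: (@le_trans _ _ ((2 ^+ j' / 2 ^+ ones (coded_weight c' e) i) ^+ 2 * 2 ^+ i)).
  by rewrite ler_wpM2r ?exprn_ge0// ler_pXn2r ?nnegrE ?divr_ge0 ?exprn_ge0.
rewrite expr_div_n mulrAC ler_pdivrMr ?exprn_gt0// mul1r -!exprM -exprD ler_eXn2l ?ltr1n//.
by have := ones_growth c' e i; lia.
Qed.

End GoodStage.

Lemma rat_approx (x e : RR) : 0 < e -> exists q : rat, `|ratr q - x| < e.
Proof.
move=> e0; have [|q] := @rat_in_itvoo _ (x - e) (x + e); first by lra.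
by rewrite in_itv/= => /andP[h1 h2]; exists q; rewrite ltr_norml; lra.
Qed.

Lemma l2_tail_small x e : l2 x -> 0 < e ->
  exists m, forall k n, (m <= k)%N -> \sum_(k <= i < n) x i ^+ 2 < e.
Proof.
move=> lx e0.
have /l2P[b hb] := lx.
(* Otherwise the partial sums could be increased by [e] any number of times and would exceed [b]. *)
have [m hm] : exists m, forall n, sqsum n x < sqsum m x + e.
  apply: contrapT => /forallNP h.
  have {}h m : exists n, sqsum m x + e <= sqsum n x.
    by have /existsNP[n /negP] := h m; rewrite -leNgt; exists n.
  have hk k : exists m, k%:R * e <= sqsum m x.
    elim: k => [|k [m hm]]; first by exists 0%N; rewrite mul0r sqsum_ge0.
    have [n hn] := h m; exists n; rewrite -natr1 mulrDl mul1r.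
    by apply: le_trans hn; rewrite lerD2r.
  have b0 : 0 <= b by apply: le_trans (hb 0%N); rewrite sqsum_ge0.
  have [m hm] := hk (Num.bound (b / e)).
  have /archi_boundP : 0 <= b / e by rewrite divr_ge0// ltW.
  rewrite ltr_pdivrMr// => hlt; have := hb m.
  by rewrite leNgt (lt_le_trans hlt hm).
exists m => k n mk; have [kn|nk] := leqP k n; last by rewrite big_geq// ltnW.
have := hm n; have := sqsum_mono x mk.
by rewrite /sqsum (big_cat_nat (leq0n k) kn)/=; lra.
Qed.

Lemma coded_vector_HC c c' e : c <> c' -> HC (coded_weight c' e) (coded_vector c).
Proof.
move=> cc; split; first exact: l2_coded_vector.
move=> y ly eps eps0; set w := coded_weight c' e.
have [d cd] : exists d, c d <> c' d.
  by apply: contrapT => /forallNP h; apply: cc; apply/funext => d; apply: contrapT.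
pose dl := eps ^+ 2 / 32.
have dl0 : 0 < dl by rewrite /dl divr_gt0// exprn_gt0.
have [m1 hm1] := l2_tail_small ly dl0.
have [m2 hm2] := geometric_small dl0.
pose m := maxn m1 m2.
have hm : (2^-1 : RR) ^+ m < dl.
  apply: le_lt_trans hm2; rewrite ler_wiXn2l ?invr_ge0 ?invf_le1 ?ler1n//.
  exact: leq_maxr.
(* The factor [2 ^ ones w i] cancels the division in [good_stage_head]. *)
have /choice[q hq] i : exists q : rat, `|ratr q - 2 ^+ ones w i * y i| < eps / 4 * 2^-1 ^+ i.
  by apply: rat_approx; rewrite mulr_gt0 ?divr_gt0// exprn_gt0// invr_gt0.
(* This prefix is long enough to contain the place [d] where [c] and [c'] differ, so the stage
   separates them. *)
have [j jm tj] := target_cofinal (mkseq c d.+1) (mkseq q m) m.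
have hj : hit c j by rewrite /hit tj size_mkseq.
have hj' : ~~ hit c' j.
  rewrite /hit tj size_mkseq; apply/eqP => /mkseq_agree/(_ d (ltnSn d)) E.
  by apply: cd.
exists (iter (block_start j) (Bw w) (coded_vector c)); first by exists (block_start j).
have hd := good_stage_head e hj hj'; have tl := good_stage_tail e hj hj'.
rewrite -/w in hd tl; move: (iter _ _ _) hd tl => z hd tl.
have hd1 i : (i < m)%N -> (z i - y i) ^+ 2 <= (eps / 4) ^+ 2 * 2^-1 ^+ i.
  move=> im; have h2 : 0 < 2 ^+ ones w i :> RR by rewrite exprn_gt0.
  have -> : z i - y i = (ratr (q i) - 2 ^+ ones w i * y i) / 2 ^+ ones w i.
    rewrite hd ?(leq_trans im)// tj nth_mkseq//.
    by rewrite mulrBl [_ * y i]mulrC mulfK// gt_eqF.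
  have h : `|(ratr (q i) - 2 ^+ ones w i * y i) / 2 ^+ ones w i| <= eps / 4 * 2^-1 ^+ i.
    rewrite normrM normfV (gtr0_norm h2) ler_pdivrMr//; apply: le_trans (ltW (hq i)) _.
    by rewrite ler_peMr ?mulr_ge0 ?divr_ge0 ?exprn_ge0 ?invr_ge0 ?(ltW eps0)// exprn_ege1// ler1n.
  rewrite -real_normK ?num_real//.
  apply: (@le_trans _ _ ((eps / 4 * 2^-1 ^+ i) ^+ 2)).
    by rewrite ler_pXn2r ?nnegrE// mulr_ge0 ?divr_ge0 ?exprn_ge0 ?invr_ge0 ?(ltW eps0).
  rewrite exprMn ler_wpM2l ?sqr_ge0// expr2 ler_piMl ?exprn_ge0 ?invr_ge0//.
  by rewrite exprn_ile1 ?invr_ge0 ?invf_le1 ?ler1n.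
have tl1 i : (m <= i)%N -> z i ^+ 2 <= 2^-1 ^+ i.
  (* Between [m] and [j] the vector [mkseq q m] has ended and [nth] gives 0. *)
  move=> mi; have [ij|ji] := ltnP i j; last exact: tl.
  by rewrite hd// tj nth_default ?size_mkseq// raddf0 mul0r expr0n exprn_ge0 ?invr_ge0.
(* Coordinates below [m] give the first summand; the others give [4 * dl] from [z] and [2 * dl] from
   [y]. The total is [5 / 16 * eps ^ 2]. *)
apply: (@l2norm_lt_sqsum _ ((eps / 4) ^+ 2 * 2 + (4 * dl + 2 * dl))) => //.
  by rewrite /dl; have := exprn_gt0 2 eps0; lra.
move=> n; apply: le_trans (sqsum_mono _ (leq_maxl n m)) _.
rewrite /sqsum (big_cat_nat (leq0n m) (leq_maxr n m))/=; apply: lerD.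
  apply: (@le_trans _ _ ((eps / 4) ^+ 2 * \sum_(0 <= i < m) 2^-1 ^+ i)).
    rewrite mulr_sumr big_nat_cond [leRHS]big_nat_cond.
    by apply: ler_sum => i /andP[/andP[_ /hd1]].
  by rewrite ler_wpM2l ?sqr_ge0//; have := geometric_sum_le 0 m; rewrite mulr1.
have h1 := sqsum_tail_le (maxn n m) tl1.
have h2 := hm1 m (maxn n m) (leq_maxl m1 m2).
apply: (@le_trans _ _ (2 * \sum_(m <= i < maxn n m) z i ^+ 2 +
  2 * \sum_(m <= i < maxn n m) y i ^+ 2)); last by lra.
rewrite !mulr_sumr -big_split/=; apply: ler_sum => i _.
by have := sqr_ge0 (z i + y i); nra.
Qed.

(** * Non-analyticity *)

(** The sets with bisouslin preimage form a sigma-algebra on [D]. There are two uses: [coded_vector]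
    with the open sets of l2, and the identity of a Polish space. *)
Lemma borel_bisouslin (T : Type) (N : nat -> T -> T -> Prop)
    (Nrefl : forall n x, N n x x) (Nsym : forall n x y, N n x y -> N n y x)
    (Ncomp : forall n, exists m, forall x y z, N m x y -> N m y z -> N n x z)
    (U : Type) (D : set U) (G : set (set U)) (f : T -> U) (A : set U) :
  (forall t, D (f t)) -> (forall O, G O -> nbhd_open N (f @^-1` O)) ->
  <<s D, G>> A -> bisouslin N (f @^-1` A).
Proof.
move=> fD fG; apply: (@smallest_sub _ _ _ [set A | bisouslin N (f @^-1` A)]).
  split=> /=.
  - by rewrite preimage_set0; apply: bisouslin_open => // x.
  - move=> B; have -> : f @^-1` (D `\` B) = ~` (f @^-1` B).
      by apply/seteqP; split=> t /= => [[]//|]; split=> //; exact: fD.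
    exact: bisouslinC.
  - by move=> F hF; rewrite preimage_bigcup; apply: bisouslin_bigcup.
by move=> O /fG; apply: bisouslin_open.
Qed.

Lemma not_l2borel_of_code (H : set seqR) :
  (forall c, H (coded_vector c) <-> ~ souslin_code c) -> ~ l2borel H.
Proof.
move=> hH bH.
have [] : bisouslin (@agree bool) (coded_vector @^-1` H).
  apply: (@borel_bisouslin _ _ _ _ _ _ _ _ _ _ _ _ bH).
  - by [].
  - by move=> n x y; apply: agreeS.
  - by move=> n; exists n => x y z; apply: agreeT.
  - exact: l2_coded_vector.
  - move=> O [_ oO] c /oO[e e0 he]; have [n hn] := coded_vector_continuous c e0.
    by exists n => c' /hn; apply: he; exact: l2_coded_vector.
move=> [K cK hK] _.
(* The diagonal lemma speaks of sequences of pairs, so the witness is put into the first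
   components. *)
apply: (@not_souslin_code_diagonal (fun c a => K c (fun n => (a n).1))).
  move=> c a h; apply: cK => n m; have [c' [a' [cc' aa' k]]] := h n m.
  by exists c', (fun n => (a' n).1); split=> // i /aa' ->.
move=> c; rewrite -hH; split=> [/hK[a ka]|[a ka]]; first by exists (fun n => (a n, 0%N)).
by apply/hK; exists (fun n => (a n).1).
Qed.

(** The preimage of [H] under [coded_vector] would be the projection of [P] below, where the first
    components witness that [b] lies in [B] and the second ones code dense points converging to [b].
    These determine [b], so closedness of [P] follows by letting [b] converge. *)
Lemma not_l2analytic_of_code (H : set seqR) :
  (forall c, H (coded_vector c) <-> ~ souslin_code c) -> ~ l2analytic H.
Proof.
move=> hH [X [B [f [[_ cX [D [cD dD]]] bB fl2 fc fB]]]].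
pose N n (x y : X) := ball x n.+1%:R^-1 y.
have ip n : 0 < n.+1%:R^-1 :> RR by rewrite invr_gt0.
have [[K cK hK] _] : bisouslin N B.
  apply: (@borel_bisouslin _ N _ _ _ _ setT open id _ _ _ bB) => //.
  - by move=> n x; apply: ballxx.
  - by move=> n x y; apply: ball_sym.
  - move=> n; exists (n.+1 + n)%N => x y z xy yz.
    rewrite /N (_ : n.+1%:R^-1 = (n.+1 + n).+1%:R^-1 + (n.+1 + n).+1%:R^-1).
      exact: ball_triangle yz.
    rewrite -addnS natrD -[X in _ = X]mulr2n -[in RHS]mulr2n -[in RHS](mulr_natl n.+1%:R) invfM.
    by rewrite -[RHS]mulr_natl mulrA divff ?mul1r// pnatr_eq0.
  - move=> O oO x Ox; have /nbhs_ballP[e e0 he] := open_nbhs_nbhs (conj oO Ox).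
    have [n hn] := harmonic_small e0; exists n => y; rewrite /N => xy; apply: he.
    exact: le_ball (ltW hn) _ xy.
have /countable_injP[g ginj] := cD.
(* Quantifying over all [e > 0] makes this a closed-ball condition, which survives limits. *)
pose P c (a : nat -> nat * nat) := exists b, [/\ B b, K b (fun n => (a n).1),
  f b = coded_vector c & forall n, exists d, [/\ D d, g d = (a n).2 &
    forall e : RR, 0 < e -> ball d (n.+1%:R^-1 + e) b]].
apply: (@not_souslin_code_diagonal P); last first.
  move=> c; rewrite -hH -fB; split=> [[b Bb fb]|[a [b [Bb _ fb _]]]]; last by exists b.
  have [a ka] := (hK b).1 Bb.
  have /choice[d hd] n : exists d, D d /\ ball d n.+1%:R^-1 b.
    have [d [/interior_subset bd Dd]] := dD _ (ex_intro _ b (nbhsx_ballx b _ (ip n)))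
      (@open_interior _ _).
    by exists d; split=> //; apply: ball_sym.
  exists (fun n => (a n, g (d n))), b; split=> // n; exists (d n).
  have [Dd bd] := hd n; split=> // e e0.
  by apply: le_ball bd; rewrite lerDl ltW.
move=> c a h.
have /choice[s hs] n : exists b, exists c' a', [/\ agree n c c', agree n a a' &
   [/\ B b, K b (fun n => (a' n).1),
  f b = coded_vector c' & forall n, exists d, [/\ D d, g d = (a' n).2 &
    forall e : RR, 0 < e -> ball d (n.+1%:R^-1 + e) b]]].
  by have [c' [a' [cc aa [b hb]]]] := h n n; exists b, c', a'.
(* All [s n] with [n > k] share the code [(a k).2], hence by injectivity of [g] the same dense
   point; this makes [s] Cauchy. *)
have sd k : exists d, [/\ D d, g d = (a k).2 &
    forall n, (k < n)%N -> forall e : RR, 0 < e -> ball d (k.+1%:R^-1 + e) (s n)].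
  have [c' [a' [_ aa [_ _ _ /(_ k)[d [Dd gd _]]]]]] := hs k.+1.
  have gd' : g d = (a k).2 by rewrite gd -aa.
  exists d; split=> // n kn e e0.
  have [c'' [a'' [_ aa'' [_ _ _ /(_ k)[d' [Dd' gd'' bd]]]]]] := hs n.
  suff -> : d = d' by exact: bd.
  by apply: ginj; rewrite ?inE// gd' gd'' -aa''.
have cauchy_s : cauchy (s @ \oo).
  apply: cauchy_exP => e e0; have [k hk] := harmonic_small (divr_gt0 e0 (ltr0n _ 2)).
  have [d [_ _ hd]] := sd k; exists d; exists k.+1 => // n /= kn.
  have /(hd _ kn) : 0 < e / 2 by rewrite divr_gt0.
  by apply: le_ball; rewrite [leRHS]splitr lerD2r ltW.
have [b sb] := cX _ _ cauchy_s.
have near_b (e : RR) m : 0 < e -> exists2 n, (m <= n)%N & ball b e (s n).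
  move=> e0; have [M _ hM] := sb _ (nbhsx_ballx b e e0).
  by exists (maxn m M); [exact: leq_maxl|apply: hM; exact: leq_maxr].
have Kb : K b (fun n => (a n).1).
  apply: cK => n m; have [M mM bM] := near_b _ m (ip n).
  have [c' [a' [_ aa [_ Ka _ _]]]] := hs M.
  by exists (s M), (fun n => (a' n).1); split=> // i im; rewrite aa ?(leq_trans im).
have Bb : B b by apply/hK; eexists; exact: Kb.
exists b; split=> //.
  (* Both sides are limits of the points [f (s n)], which are coded vectors of sequences approaching
     [c]. *)
  apply: l2_eq_of_close => [||e e0]; [exact: fl2|exact: l2_coded_vector|].
  have [d d0 hd] := fc b Bb e e0; have [n hn] := coded_vector_continuous c e0.
  have [M nM bM] := near_b d n d0.
  have [c' [a' [cc _ [Bs _ fs _]]]] := hs M.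
  exists (f (s M)), (coded_vector c'); split; [exact: fl2|exact: hd|split=> //].
  by rewrite l2distC; apply: hn; apply: agreeW cc.
move=> k; have [d [Dd gd hd]] := sd k; exists d; split=> // e e0.
have [n kn bn] := near_b (e / 2) k.+1 (divr_gt0 e0 (ltr0n _ 2)).
have := ball_triangle (hd n kn (e / 2) (divr_gt0 e0 (ltr0n _ 2))) (ball_sym bn).
by rewrite -addrA -splitr.
Qed.

(** * The set of weights *)

(** A branch is a sequence of pairs of numbers, whereas a weight stores only bits. So [e] is a total
    relation all of whose finite selections stay in the tree along [c]; the quantifiers range over
    countable sets, which makes the condition Borel. *)
Definition souslin_witness (c e : nat -> bool) : Prop :=
  (forall n : nat, exists m : nat * nat, e (pickle (n, m))) /\
  (forall s : seq (nat * nat),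
    (forall i, (i < size s)%N -> e (pickle (i, nth (0%N, 0%N) s i))) ->
    c (pickle (mkseq c (size s), s))).

Lemma souslin_witnessP c : souslin_code c <-> exists e, souslin_witness c e.
Proof.
split=> [[a ha]|[e [/choice[a ha] he]]]; last first.
  exists a => n; have := he (mkseq a n); rewrite size_mkseq; apply=> i ilt.
  by rewrite nth_mkseq.
(* The graph of the branch [a], whose only selections are the prefixes of [a]. *)
exists (fun k => if (unpickle k : option (nat * (nat * nat))) is Some (n, m)
  then m == a n else false); split=> [n|s h].
  by exists (a n); rewrite pickleK.
suff {2}-> : s = mkseq a (size s) by exact: ha.
apply: (@eq_from_nth _ (0%N, 0%N)) => [|i ilt]; first by rewrite size_mkseq.
by rewrite nth_mkseq//; have := h i ilt; rewrite pickleK => /eqP.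
Qed.

Definition code_pos (j : nat) : nat := (stage_start j + pad j)%N.
Definition decode1 (w : nat -> bool) : nat -> bool := fun j => w (code_pos j).
Definition decode2 (w : nat -> bool) : nat -> bool := fun j => w (code_pos j).+2.

Lemma coded_weight_pos c e j i : (i < 4)%N ->
  coded_weight c e (code_pos j + i) = nth false [:: c j; ~~ c j; e j; ~~ e j] i.
Proof.
move=> i4; rewrite /code_pos -addnA /coded_weight locateE; last first.
  by rewrite /stage_len /pad; lia.
rewrite /stage_bits nth_cat size_nseq ltnNge leq_addr /= addKn.
by case: i i4 => [|[|[|[|]]]].
Qed.

Lemma decode1K c e : decode1 (coded_weight c e) = c.
Proof. by apply/funext => j; rewrite /decode1 -(addn0 (code_pos j)) coded_weight_pos. Qed.

Lemma decode2K c e : decode2 (coded_weight c e) = e.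
Proof. by apply/funext => j; rewrite /decode2 -addn2 coded_weight_pos. Qed.

(** Defined by decoding and not as an image of pairs [(c, e)], because an image would at first sight
    only be analytic. *)
Definition weight_set : set cantor_space :=
  [set w : nat -> bool | (forall n, w n = coded_weight (decode1 w) (decode2 w) n) /\
           souslin_witness (decode1 w) (decode2 w)].

Lemma HCstar_weight_set c : HCstar weight_set (coded_vector c) <-> ~ souslin_code c.
Proof.
split=> [[_ h] /souslin_witnessP[e ce]|h].
  apply: (@coded_vector_not_HC c e); apply: h; split; last by rewrite decode1K decode2K.
  by move=> n; rewrite decode1K decode2K.
split=> [|w [wE ww]]; first exact: l2_coded_vector.
rewrite (_ : w = coded_weight (decode1 w) (decode2 w)); last exact/funext.
apply: coded_vector_HC => cw; apply: h; apply/souslin_witnessP.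
by exists (decode2 w); rewrite cw.
Qed.

(** * Co-analyticity *)

Lemma code_pos_mono i j : (i <= j)%N -> (code_pos i <= code_pos j)%N.
Proof. by move=> ij; have := stage_start_mono ij; rewrite /code_pos /pad; lia. Qed.

Lemma coded_weight_agree n c c' e e' : agree n.+1 c c' -> agree n.+1 e e' ->
  coded_weight c e n = coded_weight c' e' n.
Proof.
move=> cc ee; have := locate_le n; rewrite /coded_weight.
case: (locate n) => j o /= jn; rewrite /stage_bits (hit_agree cc) ?leqW//.
by rewrite cc ?ltnS// ee ?ltnS.
Qed.

Lemma decode_agree n w w' : agree (code_pos n + n + 3) w w' ->
  agree n.+1 (decode1 w) (decode1 w') /\ agree n.+1 (decode2 w) (decode2 w').
Proof.
move=> ww; split=> i; rewrite ltnS => /code_pos_mono ipos; apply: ww; lia.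
Qed.

(** * Borel sets and countable quantifiers *)

Section Borel.
Variable T : topologicalType.
Implicit Types A B : set T.

Lemma borel_open A : open A -> borel A.
Proof. by move=> oA; exact: sub_gen_smallest. Qed.

Lemma borel_not A : borel A -> borel [set t | ~ A t].
Proof.
have [_ h _] := smallest_sigma_algebra [set: T] open.
by move=> /h; rewrite setTD.
Qed.

Lemma borel_const (P : Prop) : borel [set _ : T | P].
Proof.
apply: borel_open; have [p|np] := pselect P.
  by rewrite (_ : [set _ | P] = setT); [exact: openT|apply/seteqP; split].
by rewrite (_ : [set _ | P] = set0); [exact: open0|apply/seteqP; split].
Qed.

Lemma borel_exists (I : countType) (A : I -> set T) :
  (forall i, borel (A i)) -> borel [set t | exists i, A i t].
Proof.
move=> hA; have [h0 _ h] := smallest_sigma_algebra [set: T] open.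
rewrite (_ : [set t | _] = \bigcup_n (if unpickle n is Some i then A i else set0)).
  by apply: h => n; case: unpickle.
apply/seteqP; split=> t /= => [[i Ai]|[n _]]; first by exists (pickle i); rewrite ?pickleK.
by case: unpickle => // i Ai; exists i.
Qed.

Lemma borel_forall (I : countType) (A : I -> set T) :
  (forall i, borel (A i)) -> borel [set t | forall i, A i t].
Proof.
move=> hA; rewrite (_ : [set t | _] = [set t | ~ exists i, ~ A i t]).
  by apply: borel_not; apply: borel_exists => i; apply: borel_not.
apply/seteqP; split=> t /= => [h [i]//|/forallNP h i].
by apply: contrapT; apply: h.
Qed.

Lemma borel_and A B : borel A -> borel B -> borel [set t | A t /\ B t].
Proof.
move=> hA hB; rewrite (_ : [set t | _] = [set t | forall b : bool, (if b then A else B) t]).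
  by apply: borel_forall => -[].
by apply/seteqP; split=> t /= => [[At Bt] []//|h]; split; [exact: (h true)|exact: (h false)].
Qed.

Lemma borel_or A B : borel A -> borel B -> borel [set t | A t \/ B t].
Proof.
move=> hA hB; rewrite (_ : [set t | _] = [set t | exists b : bool, (if b then A else B) t]).
  by apply: borel_exists => -[].
apply/seteqP; split=> t /= => [[At|Bt]|[[] ?]]; [by exists true|by exists false|by left|by right].
Qed.

Lemma borel_imply A B : borel A -> borel B -> borel [set t | A t -> B t].
Proof.
move=> hA hB; rewrite (_ : [set t | _] = [set t | ~ A t \/ B t]).
  by apply: borel_or => //; apply: borel_not.
by apply/seteqP; split=> t /=; have := pselect (A t); tauto.
Qed.

Variable b : T -> nat -> bool.
Hypothesis hb : forall i, borel [set t | b t i].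

(** Such a set is a countable union, over finite sequences [s], of cylinder sets. *)
Lemma borel_finite_dep (p : (nat -> bool) -> Prop) N :
  (forall w w', agree N w w' -> p w -> p w') -> borel [set t | p (b t)].
Proof.
move=> hp.
rewrite (_ : [set t | _] = [set t | exists s : seq bool,
   p (nth false s) /\ forall i : nat, (i < N)%N -> b t i = nth false s i]).
  apply: borel_exists => s; apply: borel_and; first exact: borel_const.
  apply: borel_forall => i; apply: borel_imply; first exact: borel_const.
  case: (nth false s i); first exact: hb.
  have -> : (fun t => b t i = false) = [set t | ~ b t i]; last by apply: borel_not; exact: hb.
  by apply/seteqP; split=> t /= /negP; rewrite ?negbK // => /negbTE.
apply/seteqP; split=> t /= => [pt|[s [ps bs]]]; last first.
  by apply: hp ps => i /bs ->.
exists (mkseq (b t) N); split=> [|i iN]; last by rewrite nth_mkseq.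
by apply: hp pt => i iN; rewrite nth_mkseq.
Qed.

(** The map [b] will be the identity of the Cantor space and the weight row of a [dseq]. *)
Lemma borel_weight_set_preimage : borel [set t | weight_set (b t)].
Proof.
apply: borel_and.
  apply: borel_forall => n.
  apply: (@borel_finite_dep (fun w => w n = coded_weight (decode1 w) (decode2 w) n)
    (code_pos n + n + 3)) => w w' ww wn.
  have [d1 d2] := decode_agree ww.
  by rewrite -(coded_weight_agree d1 d2) -wn -ww//; lia.
apply: borel_and.
  apply: borel_forall => n; apply: borel_exists => m; exact: hb.
apply: borel_forall => s.
apply: borel_imply.
  by apply: borel_forall => i; apply: borel_imply; [exact: borel_const|exact: hb].
(* Naming the value [u] of the prefix fixes the place at which the code is read. *)
have -> : (fun t => is_true (decode1 (b t) (pickle (mkseq (decode1 (b t)) (size s), s)))) =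
  [set t | exists u : seq bool,
    mkseq (decode1 (b t)) (size s) = u /\ decode1 (b t) (pickle (u, s))].
  by apply/seteqP; split=> t /= => [h|[u [<-]]//]; eexists; split; [reflexivity|].
apply: borel_exists => u; apply: borel_and; last exact: hb.
apply: (@borel_finite_dep (fun w => mkseq (decode1 w) (size s) = u)
  (code_pos (size s) + size s + 3)) => w w' /decode_agree[d1 _] <-.
by apply/mkseq_agree/agreeS; apply: agreeW d1.
Qed.

End Borel.

Lemma borel_weight_set : borel weight_set.
Proof.
apply: (@borel_weight_set_preimage cantor_space id) => i.
apply: borel_open.
have -> : [set t : cantor_space | t i] = proj i @^-1` [set b : bool | b] by [].
by apply: open_comp; [move=> + _; exact: proj_continuous|exact: discrete_open].
Qed.

(* The product of countably many copies of the real line, doubly indexed.  It cannot be the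
   bare function type, whose canonical metric is that of uniform convergence. *)
Record dseq := DSeq { coord : nat -> nat -> RR }.

HB.instance Definition _ := gen_eqMixin dseq.
HB.instance Definition _ := gen_choiceMixin dseq.

(** The open ball of the metric [sup min(|x t i - y t i|, 1 / (t + i + 1))]: each ball constrains
    only finitely many coordinates. *)
Definition dseq_ball (x : dseq) (e : RR) (y : dseq) : Prop :=
  0 < e /\ forall t i : nat, e * (t + i).+1%:R <= 1 -> `|coord x t i - coord y t i| < e.

Definition dseq_ent : set_system (dseq * dseq) := entourage_ dseq_ball.
Definition dseq_nbhs (x : dseq) : set_system dseq := nbhs_ dseq_ent x.

HB.instance Definition _ := hasNbhs.Build dseq dseq_nbhs.

Lemma dseq_ball_center x (e : RR) : 0 < e -> dseq_ball x e x.
Proof. by move=> e0; split=> // t i _; rewrite subrr normr0. Qed.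

Lemma dseq_ball_sym x y (e : RR) : dseq_ball x e y -> dseq_ball y e x.
Proof. by move=> [e0 h]; split=> // t i /h; rewrite distrC. Qed.

Lemma dseq_ball_triangle x y z e1 e2 :
  dseq_ball x e1 y -> dseq_ball y e2 z -> dseq_ball x (e1 + e2) z.
Proof.
move=> [e10 h1] [e20 h2]; split=> [|t i hti]; first exact: addr_gt0.
have k0 : 0 <= (t + i).+1%:R :> RR by [].
have /h1 l1 : e1 * (t + i).+1%:R <= 1.
  by apply: le_trans hti; rewrite ler_wpM2r// lerDl ltW.
have /h2 l2 : e2 * (t + i).+1%:R <= 1.
  by apply: le_trans hti; rewrite ler_wpM2r// lerDr ltW.
by apply: le_lt_trans (ler_distD (coord y t i) _ _) _; rewrite ltrD.
Qed.

Lemma dseq_nbhsE : @nbhs dseq dseq = nbhs_ dseq_ent. Proof. by []. Qed.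
Lemma dseq_entE : dseq_ent = entourage_ dseq_ball. Proof. by []. Qed.

HB.instance Definition _ := @Nbhs_isPseudoMetric.Build RR dseq
  dseq_ent dseq_nbhsE dseq_ball dseq_ball_center dseq_ball_sym dseq_ball_triangle dseq_entE.

Lemma coord_close t i (e : RR) : 0 < e ->
  exists2 d : RR, 0 < d & forall x y : dseq, ball x d y -> `|coord x t i - coord y t i| < e.
Proof.
move=> e0; exists (Num.min e (t + i).+1%:R^-1).
  by rewrite lt_min e0 invr_gt0 ltr0n.
move=> x y [_ h]; apply: lt_le_trans (h t i _) _; last by rewrite ge_min lexx.
by rewrite -ler_pdivlMr// mul1r ge_min lexx orbT.
Qed.

Lemma coord_continuous t i : continuous (fun x : dseq => coord x t i).
Proof.
move=> x; apply/(@cvg_ballP _ _ _ (nbhs x) (nbhs_filter x)) => e e0; have [d d0 hd] := coord_close t i e0.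
by apply/nbhs_ballP; exists d => //= y /hd.
Qed.

Lemma dseq_ball_finite (e : RR) : 0 < e -> exists M : nat, forall x y : dseq,
  (forall t i, (t < M)%N -> (i < M)%N -> `|coord x t i - coord y t i| < e) -> ball x e y.
Proof.
move=> e0; exists (Num.bound e^-1) => x y h; split=> // t i.
rewrite -ler_pdivlMl// mulr1 => hti.
have := le_lt_trans hti (archi_boundP (ltW (etrans (invr_gt0 e) e0))).
by rewrite ltr_nat => /ltnW lt; apply: h;
  [exact: leq_ltn_trans (leq_addr i t) lt|exact: leq_ltn_trans (leq_addl t i) lt].
Qed.

Lemma polish_dseq : polish dseq.
Proof.
split.
- rewrite ball_hausdorff => x y xy.
  have [t [i ti]] : exists t i, coord x t i <> coord y t i.
    apply: contrapT => /forallNP h; move/eqP: xy; apply.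
    case: x y h => x [y] /= h; congr DSeq; apply/funext => t; apply/funext => i.
    by apply: contrapT => ti; apply: (h t); exists i.
  have e0 : 0 < `|coord x t i - coord y t i| / 2.
    by rewrite divr_gt0// normr_gt0 subr_eq0; apply/eqP.
  have [d d0 hd] := coord_close t i e0.
  exists (PosNum d0, PosNum d0) => /=; apply/eqP/seteqP; split=> // z [/hd xz /hd yz].
  have := ler_distD (coord z t i) (coord x t i) (coord y t i).
  rewrite leNgt [X in _ + X]distrC => /negP; apply.
  by rewrite [ltRHS]splitr ltrD.
- move=> F FF cF.
  have lim t i : exists l : RR, (fun x : dseq => coord x t i) @ F --> l.
    apply/cvg_ex; apply: (@R_complete RR); apply: cauchy_exP => e e0.
    have [d d0 hd] := coord_close t i e0.
    have [x Fx] := (cauchyP F).1 cF d d0.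
    exists (coord x t i).
    by apply: (@filterS _ F _ (ball x d) _ _ Fx) => y /hd.
  have /choice[l hl] t : exists l : nat -> RR, forall i, (fun x : dseq => coord x t i) @ F --> l i.
    by have /choice[l hl] := lim t; exists l.
  exists (DSeq l) => A /nbhs_ballP[e e0 eA]; apply: filterS eA _.
  have [M hM] := dseq_ball_finite e0.
  have : \forall x \near F, forall u : 'I_M * 'I_M, `|l u.1 u.2 - coord x u.1 u.2| < e.
    apply: filter_forall => -[t i] /=.
    by have /cvg_ballP/(_ _ e0) := hl t i.
  apply: filterS => x hx; apply: hM => t i tM iM.
  exact: (hx (Ordinal tM, Ordinal iM)).
(* Finitely supported rational arrays are dense, since a ball constrains only finitely many
   coordinates. *)
- exists (range (fun s : seq (seq rat) => DSeq (fun t i => ratr (nth 0 (nth [::] s t) i)))).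
  split; first by apply: sub_countable (card_image_le _ _) _; exact: countableP.
  move=> O [x Ox] oO; have /nbhs_ballP[e e0 he] := open_nbhs_nbhs (conj oO Ox).
  have [M hM] := dseq_ball_finite e0.
  have /choice[q hq] t : exists q : nat -> rat, forall i, `|ratr (q i) - coord x t i| < e.
    by have /choice[q hq] := fun i => rat_approx (coord x t i) e0; exists q.
  exists (DSeq (fun t i => ratr (nth 0 (nth [::] (mkseq (fun t => mkseq (q t) M) M) t) i))).
  split; last by eexists.
  apply: he; apply: hM => t i tM iM /=.
  by rewrite nth_mkseq// nth_mkseq// distrC.
Qed.

(** * Borel conditions given by continuous functions *)

Section ContinuousBorel.
Variable T : topologicalType.
Implicit Types f g : T -> RR.

Lemma continuous_const (r : RR) : continuous (fun _ : T => r).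
Proof. by move=> t; exact: cvg_cst. Qed.

Lemma continuous_mul f g :
  continuous f -> continuous g -> continuous (fun t => f t * g t).
Proof. by move=> cf cg t; apply: cvgM; [exact: cf|exact: cg]. Qed.

Lemma continuous_add f g :
  continuous f -> continuous g -> continuous (fun t => f t + g t).
Proof. by move=> cf cg t; apply: (@continuousD RR RR^o); [exact: cf|exact: cg]. Qed.

Lemma continuous_sub f g :
  continuous f -> continuous g -> continuous (fun t => f t - g t).
Proof. by move=> cf cg t; apply: (@continuousB RR RR^o); [exact: cf|exact: cg]. Qed.

Lemma borel_gt0 f : continuous f -> borel [set t | 0 < f t].
Proof.
move=> cf; apply: borel_open.
have -> : [set t | 0 < f t] = f @^-1` [set x : RR | 0 < x] by [].
by apply: open_comp => [t _|]; [exact: cf|exact: open_gt].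
Qed.

Lemma borel_lt f g : continuous f -> continuous g -> borel [set t | f t < g t].
Proof.
move=> cf cg; have -> : [set t | f t < g t] = [set t | 0 < g t - f t].
  by apply/seteqP; split=> t /=; rewrite subr_gt0.
by apply: borel_gt0; apply: continuous_sub.
Qed.

Lemma borel_le f g : continuous f -> continuous g -> borel [set t | f t <= g t].
Proof.
move=> cf cg; have -> : [set t | f t <= g t] = [set t | ~ g t < f t].
  by apply/seteqP; split=> t /=; rewrite leNgt => /negP.
by apply: borel_not; apply: borel_lt.
Qed.

Lemma borel_eq f g : continuous f -> continuous g -> borel [set t | f t = g t].
Proof.
move=> cf cg; have -> : [set t | f t = g t] = [set t | f t <= g t /\ g t <= f t].
  by apply/seteqP; split=> t /= => [->//|/andP]; rewrite -eq_le => /eqP.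
by apply: borel_and; apply: borel_le.
Qed.

Lemma continuous_sum (I : Type) (r : seq I) (F : I -> T -> RR) :
  (forall i, continuous (F i)) -> continuous (fun t => \sum_(i <- r) F i t).
Proof.
move=> cF; elim: r => [|i r IH].
  by under eq_fun do rewrite big_nil; exact: continuous_const.
by under eq_fun do rewrite big_cons; apply: continuous_add.
Qed.

Lemma continuous_prod (I : Type) (r : seq I) (F : I -> T -> RR) :
  (forall i, continuous (F i)) -> continuous (fun t => \prod_(i <- r) F i t).
Proof.
move=> cF; elim: r => [|i r IH].
  by under eq_fun do rewrite big_nil; exact: continuous_const.
by under eq_fun do rewrite big_cons; apply: continuous_mul.
Qed.

Lemma continuous_sqsum n (F : nat -> T -> RR) :
  (forall i, continuous (F i)) -> continuous (fun t => sqsum n (fun i => F i t)).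
Proof.
move=> cF; apply: continuous_sum => i.
by under eq_fun do rewrite expr2; apply: continuous_mul.
Qed.

End ContinuousBorel.

Lemma borel_coord_weight i : borel [set z : dseq | coord z 2 i == 2].
Proof.
have -> : [set z : dseq | coord z 2 i == 2] = [set z | coord z 2 i = 2].
  by apply/seteqP; split=> z /= /eqP.
by apply: borel_eq; [exact: coord_continuous|exact: continuous_const].
Qed.

(** The difference between the [k]-th orbit point and row 1, written as polynomials in the entries
    of [z] so that each coordinate is continuous. *)
Definition shifted_coord (z : dseq) (k : nat) : seqR := fun i =>
  (\prod_(0 <= t < k) coord z 2 (i + t)) * coord z 0 (i + k) - coord z 1 i.

(* Row 0 is [x], row 1 a vector avoided by the orbit of [x], row 2 the weight, and the first
   entry of row 3 the squared norm of [x]. *)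
Definition nonHC_pairs : set dseq := [set z |
  (forall n, sqsum n (coord z 0) <= coord z 3 0) /\
  (forall k : nat, exists n : nat, coord z 3 0 < sqsum n (coord z 0) + k.+1%:R^-1) /\
  (exists M : nat, forall n, sqsum n (coord z 1) <= M%:R) /\
  (forall i, coord z 2 i = 1 \/ coord z 2 i = 2) /\
  weight_set (fun i => coord z 2 i == 2) /\
  (exists j : nat, forall k : nat, exists n : nat,
    j.+1%:R^-1 < sqsum n (shifted_coord z k))].

Lemma borel_nonHC_pairs : borel nonHC_pairs.
Proof.
have cc t i := @coord_continuous t i.
have ck (r : RR) := @continuous_const dseq r.
have cs t n : continuous (fun z => sqsum n (coord z t)) by apply: continuous_sqsum.
apply: borel_and; first by apply: borel_forall => n; apply: borel_le.
apply: borel_and.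
  apply: borel_forall => k; apply: borel_exists => n; apply: borel_lt => //.
  exact: continuous_add.
apply: borel_and.
  by apply: borel_exists => M; apply: borel_forall => n; apply: borel_le.
apply: borel_and.
  by apply: borel_forall => i; apply: borel_or; apply: borel_eq.
apply: borel_and; first by apply: borel_weight_set_preimage; exact: borel_coord_weight.
apply: borel_exists => j; apply: borel_forall => k; apply: borel_exists => n.
apply: borel_lt => //; apply: continuous_sqsum => i.
apply: continuous_sub => //; apply: continuous_mul => //.
by apply: continuous_prod => j'.
Qed.

Lemma l2_coord0 z : nonHC_pairs z -> l2 (coord z 0).
Proof. by move=> [h _]; apply/l2P; exists (coord z 3 0). Qed.

(* The coordinate carrying the squared norm upgrades coordinatewise convergence to
   convergence in norm. *)
Lemma coord0_continuous z (e : RR) : nonHC_pairs z -> 0 < e -> exists2 d : RR, 0 < d &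
  forall y, nonHC_pairs y -> ball z d y -> l2dist (coord z 0) (coord y 0) < e.
Proof.
move=> [zle [zlt _]] e0; pose dl := e ^+ 2 / 16.
have dl0 : 0 < dl by rewrite divr_gt0// exprn_gt0.
have [k hk] := harmonic_small dl0; have [n hn] := zlt k.
have near_cont (g : dseq -> RR) : continuous g -> \forall y \near z, `|g z - g y| < dl.
  by move=> /(_ z)/cvg_ballP/(_ _ dl0).
have : \forall y \near z, [/\ `|coord z 3 0 - coord y 3 0| < dl,
   `|sqsum n (coord z 0) - sqsum n (coord y 0)| < dl &
   sqsum n (fun i => coord z 0 i - coord y 0 i) < dl].
  near=> y; split.
  - by near: y; apply: near_cont; exact: coord_continuous.
  - by near: y; apply: (near_cont (fun y => sqsum n (coord y 0)));
      apply: continuous_sqsum => i; exact: coord_continuous.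
  - near: y; have := near_cont (fun y => sqsum n (fun i => coord z 0 i - coord y 0 i)).
    have -> : sqsum n (fun i => coord z 0 i - coord z 0 i) = 0.
      by rewrite /sqsum big1// => i _; rewrite subrr expr0n.
    move=> h; apply: filterS (h _) => [y|].
      by rewrite sub0r normrN ger0_norm// sqsum_ge0.
    apply: continuous_sqsum => i.
    by apply: continuous_sub; [exact: continuous_const|exact: coord_continuous].
move=> /nbhs_ballP[d d0 hd]; exists d => // y [yle _] /hd[h1 h2 h3].
(* Below [n] the difference contributes less than [dl]. The tail of [z] is below [dl] and, comparing
   norms and partial sums, that of [y] below [3 * dl]; both count twice. *)
apply: (@l2norm_lt_sqsum _ (9 * dl)) => //; first by rewrite /dl; have := exprn_gt0 2 e0; lra.
move=> N; apply: le_trans (sqsum_mono _ (leq_maxl N n)) _.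
have nN := leq_maxr N n; set M := maxn N n in nN *.
have tail (x : seqR) : sqsum M x = sqsum n x + \sum_(n <= i < M) x i ^+ 2.
  by rewrite /sqsum (big_cat_nat (leq0n n) nN).
have tB : \sum_(n <= i < M) (coord z 0 i - coord y 0 i) ^+ 2 <=
    2 * \sum_(n <= i < M) coord z 0 i ^+ 2 + 2 * \sum_(n <= i < M) coord y 0 i ^+ 2.
  rewrite !mulr_sumr -big_split/=; apply: ler_sum => i _.
  by have := sqr_ge0 (coord z 0 i + coord y 0 i); nra.
have := zle M; have := yle M; rewrite !tail /= => ty tz.
have arith (a b sa sb ta tb D D' : RR) : `|a - b| < dl -> `|sa - sb| < dl -> D < dl ->
    D' <= 2 * ta + 2 * tb -> a < sa + dl -> sa + ta <= a -> sb + tb <= b -> D + D' <= 9 * dl.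
  by rewrite !ltr_norml => /andP[? ?] /andP[? ?] *; lra.
apply: (arith _ _ _ _ _ _ _ _ h1 h2 h3 tB _ tz ty).
by apply: lt_trans hn _; rewrite ltrD2l.
Unshelve. all: by end_near. Qed.

Lemma shifted_coordE (z : dseq) (w : nat -> bool) k :
  (forall i, coord z 2 i = weight (w i)) ->
  shifted_coord z k = fun i => iter k (Bw w) (coord z 0) i - coord z 1 i.
Proof.
move=> h; apply/funext => i; rewrite iter_BwE /shifted_coord; congr (_ * _ - _).
by apply: eq_bigr => t _; rewrite h.
Qed.

Lemma not_HC_of_pair z : nonHC_pairs z -> ~ HC (fun i => coord z 2 i == 2) (coord z 0).
Proof.
move=> hz; have lx := l2_coord0 hz.
have [_ [_ [[M hM] [hw [_ [j hj]]]]]] := hz.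
set w := fun i => coord z 2 i == 2.
have wE i : coord z 2 i = weight (w i).
  by rewrite /w /weight; case: (hw i) => ->; [rewrite ifN// lt_eqF// ltr1n|rewrite eqxx].
have ly : l2 (coord z 1) by apply/l2P; exists M%:R.
(* The gap [1 / (j + 1)] is one of squared distances; being at most 1, it also serves as a
   radius. *)
move=> [_ /(_ _ ly j.+1%:R^-1)] [|_ [k _ <-] hd]; first by rewrite invr_gt0.
have [n] := hj k; rewrite (shifted_coordE _ wE) => hn.
have := sqsum_le_l2norm n (l2B (l2_iter_Bw w k lx) ly).
rewrite -/(l2dist _ _); move: hd; set d := l2dist _ _ => hd.
have d0 : 0 <= d by exact: l2norm_ge0.
have : j.+1%:R^-1 <= 1 :> RR by rewrite invf_le1// ler1n.
move: hn hd; set s := sqsum _ _; set r := j.+1%:R^-1 => hn hd r1 hs.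
have : d ^+ 2 <= r * 1 by rewrite expr2; apply: ler_pM => //; [exact: ltW|apply: le_trans r1; exact: ltW].
by lra.
Qed.

Lemma nonHC_pairs_image : (fun z => coord z 0) @` nonHC_pairs = l2 `\` HCstar weight_set.
Proof.
apply/seteqP; split=> [_ [z hz <-]|x [lx hx]].
  split; first exact: l2_coord0.
  move=> [_ /(_ (fun i => coord z 2 i == 2))] H; apply: (not_HC_of_pair hz); apply: H.
  by case: hz => _ [_ [_ [_ []]]].
have [w Ww nHC] : exists2 w, weight_set w & ~ HC w x.
  apply: contrapT => h; apply: hx; split=> // w Ww; apply: contrapT => nH.
  by apply: h; exists w.
have [y ly [e e0 he]] : exists2 y, l2 y & exists2 e, 0 < e &
    forall k, ~ l2dist (iter k (Bw w) x) y < e.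
  apply: contrapT => h; apply: nHC; split=> // y ly e e0; apply: contrapT => h'.
  apply: h; exists y => //; exists e => // k hk; apply: h'.
  by exists (iter k (Bw w) x) => //; exists k.
pose z := DSeq (fun t i => if t is 0%N then x i else if t is 1%N then y i
  else if t is 2%N then weight (w i) else l2norm x ^+ 2).
have wz : (fun i => coord z 2 i == 2) = w.
  apply/funext => i /=; rewrite /weight; case: (w i); first by rewrite eqxx.
  by rewrite lt_eqF// ltr1n.
have [b hb] := (l2P y).1 ly.
exists z => //; split; first by move=> n; exact: sqsum_le_l2norm.
split.
  move=> k; apply: contrapT => /forallNP h.
  (* Otherwise a number smaller than the squared norm would bound all partial sums. *)
  have : l2norm x ^+ 2 <= l2norm x ^+ 2 - k.+1%:R^-1.
    apply: l2norm_le_sqsum => n; have /negP := h n.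
    by rewrite -leNgt/= => h'; rewrite lerBrDr.
  by rewrite lerBrDr gerDl leNgt invr_gt0 ltr0n.
split.
  exists (Num.bound b) => n; apply: le_trans (hb n) (ltW (archi_boundP _)).
  by apply: le_trans (hb 0%N); exact: sqsum_ge0.
split; first by move=> i /=; rewrite /weight; case: (w i); [right|left].
split; first by rewrite wz.
have [j hj] := harmonic_small (exprn_gt0 2 e0).
exists j => k; apply: contrapT => /forallNP h; apply: (he k).
apply: (l2norm_lt_sqsum e0 hj) => n; rewrite -(shifted_coordE (z := z) (w := w))//.
by rewrite leNgt; apply/negP; exact: h.
Qed.

Lemma l2coanalytic_HCstar : l2coanalytic (HCstar weight_set).
Proof.
exists dseq, nonHC_pairs, (fun z => coord z 0); split.
- exact: polish_dseq.
- exact: borel_nonHC_pairs.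
- exact: l2_coord0.
- by move=> z hz e e0; exact: coord0_continuous.
- exact: nonHC_pairs_image.
Qed.

Theorem theorem2 :
  exists W : set cantor_space,
    borel W /\
    l2coanalytic (HCstar W) /\ ~ l2analytic (HCstar W) /\
    ~ l2borel (HCstar W).
Proof.
exists weight_set; split; first exact: borel_weight_set.
split; first exact: l2coanalytic_HCstar.
split; [apply: not_l2analytic_of_code|apply: not_l2borel_of_code];
  exact: HCstar_weight_set.
Qed.
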